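(* Let $K$ be a closed subset of $\mathbb{H}$ and let $E$ be a two-sided $\mathbb{H}$-linear subspace of $C(K;\mathbb{H})$ which is $*$-invariant. Let $L:E\to\mathbb{H}$ be an $\mathbb{H}$-linear functional on $E$. Suppose that there exists a positive Radon measure $\mu$ on $K$ such that $L(f)=\int_K f(x)\,d\mu(x)$ for all $f\in E_{\mathrm{her}}$. Suppose that the vector space $E$ is finite dimensional. Then there exists a finitely atomic measure $\nu=\sum_{j=1}^n c_j\delta_{x_j}$, where $c_j\ge 0$ and $x_j\in K$ for $j=1,\dots,n$ and $n\le\dim E_{\mathrm{her}}$, such that $\nu$ is a representing measure for $L$, that is, $$L(f)=\int_K f(x)\,d\nu(x)=\sum_{j=1}^n c_jf(x_j)\quad\text{for all } f\in E.$$
   Context: $\mathbb{H}$ is the algebra of quaternions $q=x_0+x_1\mathrm{i}+x_2\mathrm{j}+x_3\mathrm{k}$, identified topologically with $\mathbb{R}^4$, with conjugation $q^*=x_0-x_1\mathrm{i}-x_2\mathrm{j}-x_3\mathrm{k}$. $C(K;\mathbb{H})$ denotes the continuous $\mathbb{H}$-valued functions on $K$ with pointwise operations, and $f^*(x):=f(x)^*$. $E$ is two-sided $\mathbb{H}$-linear if $afb+cgd\in E$ for all $f,g\in E$, $a,b,c,d\in\mathbb{H}$; $*$-invariant if $f\in E$ implies $f^*\in E$. $E_{\mathrm{her}}:=\{f\in E: f=f^*\}$ is the real vector space of real-valued functions in $E$; $\dim E_{\mathrm{her}}$ is its real dimension. An $\mathbb{H}$-linear functional is a map $L:E\to\mathbb{H}$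 with $L(afb+cgd)=aL(f)b+cL(g)d$ for all $f,g\in E$, $a,b,c,d\in\mathbb{H}$. $\delta_x$ is the unit point mass at $x$. Integrals of $\mathbb{H}$-valued functions are componentwise, and integral formulas include integrability. *)

(* Defs.v *)
From HB Require Import structures.
From mathcomp Require Import all_boot all_order all_algebra.
From mathcomp Require Import all_classical all_reals all_analysis.
From mathcomp Require Import ring.
Set Implicit Arguments.
Unset Strict Implicit.
Unset Printing Implicit Defensive.
Import Order.TTheory GRing.Theory Num.Theory.
Import numFieldNormedType.Exports.
Local Open Scope classical_set_scope.
Local Open Scope ring_scope.

(* The coordinates 0, 1, 2, 3 are those on 1, i, j, k; the topology is that of
   R^4 (the norm inherited from 'rV_4 is the sup norm). *)
Definition quat (R : realType) : Type := 'rV[R]_4.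

Section quaternions.
Variable R : realType.

HB.instance Definition _ := NormedModule.copy (quat R) 'rV[R]_4.

Definition mkquat (a b c d : R) : quat R :=
  \row_(i < 4) nth 0 [:: a; b; c; d] i.

Definition q0 (p : quat R) : R := p 0 (@Ordinal 4 0 isT).
Definition q1 (p : quat R) : R := p 0 (@Ordinal 4 1 isT).
Definition q2 (p : quat R) : R := p 0 (@Ordinal 4 2 isT).
Definition q3 (p : quat R) : R := p 0 (@Ordinal 4 3 isT).

Definition qone : quat R := mkquat 1 0 0 0.

Definition qmul (p q : quat R) : quat R :=
  mkquat (q0 p * q0 q - q1 p * q1 q - q2 p * q2 q - q3 p * q3 q)
         (q0 p * q1 q + q1 p * q0 q + q2 p * q3 q - q3 p * q2 q)
         (q0 p * q2 q - q1 p * q3 q + q2 p * q0 q + q3 p * q1 q)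
         (q0 p * q3 q + q1 p * q2 q - q2 p * q1 q + q3 p * q0 q).

Definition qconj (p : quat R) : quat R :=
  mkquat (q0 p) (- q1 p) (- q2 p) (- q3 p).

Lemma quatP (p q : quat R) :
  q0 p = q0 q -> q1 p = q1 q -> q2 p = q2 q -> q3 p = q3 q -> p = q.
Proof.
move=> h0 h1 h2 h3; apply/rowP => -[i lti].
case: i lti => [|[|[|[|//]]]] lti.
- by rewrite (_ : Ordinal lti = @Ordinal 4 0 isT) //; apply: val_inj.
- by rewrite (_ : Ordinal lti = @Ordinal 4 1 isT) //; apply: val_inj.
- by rewrite (_ : Ordinal lti = @Ordinal 4 2 isT) //; apply: val_inj.
- by rewrite (_ : Ordinal lti = @Ordinal 4 3 isT) //; apply: val_inj.
Qed.

Lemma mkquatE (a b c d : R) :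
  ((q0 (mkquat a b c d) = a) * (q1 (mkquat a b c d) = b) *
   (q2 (mkquat a b c d) = c) * (q3 (mkquat a b c d) = d))%type.
Proof. by rewrite /q0 /q1 /q2 /q3 !mxE. Qed.

Lemma quatDE (p q : quat R) :
  ((q0 (p + q) = q0 p + q0 q)%R * (q1 (p + q) = q1 p + q1 q)%R *
   (q2 (p + q) = q2 p + q2 q)%R * (q3 (p + q) = q3 p + q3 q)%R)%type.
Proof. by rewrite /q0 /q1 /q2 /q3 !mxE. Qed.

Lemma qmulA : associative qmul.
Proof. by move=> p q r; apply: quatP; rewrite !mkquatE; ring. Qed.

Lemma qmul1l : left_id qone qmul.
Proof. by move=> p; apply: quatP; rewrite !mkquatE; ring. Qed.

Lemma qmul1r : right_id qone qmul.
Proof. by move=> p; apply: quatP; rewrite !mkquatE; ring. Qed.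

Lemma qmulDl : left_distributive qmul +%R.
Proof. by move=> p q r; apply: quatP; rewrite !(quatDE, mkquatE); ring. Qed.

Lemma qmulDr : right_distributive qmul +%R.
Proof. by move=> p q r; apply: quatP; rewrite !(quatDE, mkquatE); ring. Qed.

Lemma qone_neq0 : qone != 0.
Proof.
apply/eqP => /rowP /(_ (@Ordinal 4 0 isT)); rewrite !mxE /= => /eqP.
by rewrite oner_eq0.
Qed.

HB.instance Definition _ := GRing.Zmodule_isNzRing.Build (quat R)
  qmulA qmul1l qmul1r qmulDl qmulDr qone_neq0.

End quaternions.

Section dimension.
Variables (A : nzRingType) (V : lmodType A) (W : set V).

Definition is_basis (d : nat) (e : 'I_d -> V) : Prop :=
  [/\ forall i, W (e i),
      forall a : 'I_d -> A, \sum_i a i *: e i = 0 -> forall i, a i = 0 &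
      forall w, W w -> exists a : 'I_d -> A, w = \sum_i a i *: e i].

Definition has_dim (d : nat) : Prop := exists e : 'I_d -> V, is_basis e.

Definition finite_dim : Prop := exists d, has_dim d.

End dimension.

Section functions_on_K.
Variables (R : realType) (K : set (quat R)).
Implicit Types (E : set (K -> quat R)) (L : (K -> quat R) -> quat R).

Definition lincomb (a : quat R) (f : K -> quat R) (b : quat R)
    (c : quat R) (g : K -> quat R) (d : quat R) : K -> quat R :=
  fun x => a * f x * b + c * g x * d.

Definition two_sided_subspace E : Prop :=
  E 0 /\ forall f g a b c d, E f -> E g -> E (lincomb a f b c g d).

Definition star (f : K -> quat R) : K -> quat R := fun x => qconj (f x).

Definition star_invariant E : Prop := forall f, E f -> E (star f).

Definition her E : set (K -> quat R) := [set f | E f /\ f = star f].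

(* L is a total function, but only its restriction to E is constrained. *)
Definition linear_functional_on E L : Prop :=
  forall f g a b c d, E f -> E g ->
    L (lincomb a f b c g d) = a * L f * b + c * L g * d.

End functions_on_K.

Definition borel_quat (R : realType) := g_sigma_algebraType (@open (quat R)).

(* Since K is closed, Radon measures on K are identified with the Radon measures
   on the whole space that do not charge the complement of K; this also
   accommodates the case where K is empty (a measurableType is pointed). *)
Definition radon_on (R : realType) (K : set (quat R))
    (mu : {measure set (borel_quat R) -> \bar R}) : Prop :=
  [/\ forall C : set (quat R), compact C -> (mu C < +oo)%E,
      forall A : set (borel_quat R), measurable A ->
        mu A = ereal_sup
          [set mu C | C in [set C : set (quat R) | compact C /\ C `<=` A]] &
      mu (~` K) = 0%E].

Section integral.
Variables (R : realType) (K : set (quat R)).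
Variable mu : {measure set (borel_quat R) -> \bar R}.

(* The extension by 0 of f is irrelevant: integrals are taken over K. *)
Definition coordK (f : K -> quat R) (i : 'I_4) : borel_quat R -> R :=
  fun x => (valL_ 0 f x : quat R) 0 i.

Definition qintegrable (f : K -> quat R) : Prop :=
  forall i, mu.-integrable K (EFin \o coordK f i).

Definition qintegral (f : K -> quat R) : quat R :=
  \row_(i < 4) \int[mu]_(x in K) coordK f i x.

End integral.

Section atomic.
Context d (T : measurableType d) (R : realType) (n : nat).
Variables (c : 'I_n -> {nonneg R}) (x : 'I_n -> T).
Local Open Scope ereal_scope.

Definition atomic (A : set T) : \bar R :=
  \sum_(j < n) (c j)%:num%:E * \d_(x j) A.

Let m (k : nat) : {measure set T -> \bar R} :=
  if insub k is Some j then mscale (c j) (dirac (x j)) else mzero.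

Let atomicE : atomic = msum m n.
Proof.
apply/funext => A; rewrite /atomic /msum; apply: eq_bigr => j _.
by rewrite /m valK.
Qed.

Let atomic0 : atomic set0 = 0. Proof. by rewrite atomicE measure0. Qed.

Let atomic_ge0 A : 0 <= atomic A.
Proof. by rewrite atomicE measure_ge0. Qed.

Let atomic_sigma_additive : semi_sigma_additive atomic.
Proof. by rewrite atomicE; exact: measure_semi_sigma_additive. Qed.

HB.instance Definition _ := isMeasure.Build _ _ _
  atomic atomic0 atomic_ge0 atomic_sigma_additive.

End atomic.

(* Main.v *)
Require Import Defs.
From HB Require Import structures.
From mathcomp Require Import all_boot all_order all_algebra.
From mathcomp Require Import all_classical all_reals all_analysis.
From mathcomp Require Import measurable_realfun ring lra.
Import Order.TTheory GRing.Theory Num.Theory.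
Import numFieldNormedType.Exports.
Local Open Scope classical_set_scope.
Local Open Scope ring_scope.

(** Since [f] is a combination of its four coordinate functions, which lie in
    [her E], two functionals on [E] that agree on [her E] are equal, so it
    suffices to represent [L] on [her E].

    Let [phi] be the map to [R^d] given by a basis of [her E]. Its integral [s]
    lies in the convex cone generated by [phi @` K] (Richter): otherwise some
    nonzero linear form is nonnegative on that cone and nonpositive at [s],
    hence vanishes along [phi] almost everywhere; this expresses one component
    of [phi] through the others on a set of full measure, and one concludes by
    induction on [d]. The cone need not be closed, so the linear form is
    obtained algebraically, by enlarging the lineality space of the cone to a
    hyperplane. Caratheodory's argument then brings the number of atoms down to [d]. *)

(** * Convex cones and supporting linear forms *)

Definition convex_cone {R : realType} {V : lmodType R} (C : set V) : Prop :=
  [/\ C 0, forall x y, C x -> C y -> C (x + y) &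
      forall (t : R) x, 0 <= t -> C x -> C (t *: x)].

(** This set is the Minkowski sum of [C] and the line spanned by [v], the tool for enlarging the
    lineality space. *)
Lemma convex_cone_add_line {R : realType} {V : lmodType R} (C : set V) (v : V) :
  convex_cone C -> convex_cone [set x | exists t : R, C (x + t *: v)].
Proof.
move=> [C0 CD CZ]; split=> /=.
- by exists 0; rewrite scale0r addr0.
- move=> x y [s Cs] [t Ct]; exists (s + t).
  by rewrite scalerDl addrACA; exact: CD.
- move=> t x t0 [s Cs]; exists (t * s).
  by rewrite -scalerA -scalerDr; exact: CZ.
Qed.

(* One can take for [tau] the supremum of the [t] such that [C (w + t *: p)]. *)
Lemma convex_cone_line {R : realType} {V : lmodType R} (C : set V) (p w : V) :
  convex_cone C -> ~ C p ->
  (forall x, exists t : R, C (x + t *: p)) ->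
  exists tau : R, forall t : R, ~ C (p + t *: (w + tau *: p)).
Proof.
move=> [C0 CD CZ] Cp Call.
pose T : set R := [set t | C (w + t *: p)].
(* If [t + t' > 0], the sum of the two vectors is a positive multiple of [p] in [C], which puts [p]
   in [C]. *)
have T_ub t t' : T t -> C (- w + t' *: p) -> t <= - t'.
  move=> Tt Ct'; rewrite leNgt; apply/negP => lt_t; apply: Cp.
  have d0 : 0 < t + t' by lra.
  have := CZ (t + t')^-1 _ _ (CD _ _ Tt Ct').
  rewrite addrACA subrr add0r -scalerDl scalerA mulVf ?gt_eqF// scale1r.
  by apply; rewrite invr_ge0 ltW.
have supT : has_sup T.
  split; first exact: Call.
  have [t' Ct'] := Call (- w); exists (- t') => t Tt; exact: T_ub Ct'.
(* Dividing by [|t|]: for [t > 0] the number [sup T + t^-1] lies in [T], and for [t < 0] it is an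
   upper bound of [T] below [sup T]. Both are absurd. *)
exists (sup T) => t Ct; have [t0|t0|t0] := ltgtP t 0.
- have le_sup : sup T <= - (- sup T - t^-1).
    apply: ge_sup supT.1 _ => s Ts; apply: T_ub => //.
    have := CZ (- t)^-1 _ _ Ct.
    rewrite scalerDr scalerA -mulrN1 invfM invrN1 mulrN1 mulNr mulVf ?lt_eqF//.
    rewrite scaleN1r opprD -scaleNr addrC -addrA -scalerDl.
    by apply; rewrite oppr_ge0 invr_le0 ltW.
  have : t^-1 < 0 by rewrite invr_lt0.
  lra.
- have le_sup : sup T + t^-1 <= sup T.
    apply: (ub_le_sup supT.2) => /=.
    have := CZ t^-1 _ _ Ct.
    rewrite scalerDr scalerA mulVf ?gt_eqF// scale1r addrC -addrA -scalerDl.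
    by apply; rewrite invr_ge0 ltW.
  have : 0 < t^-1 by rewrite invr_gt0.
  lra.
- by move: Ct; rewrite t0 scale0r addr0.
Qed.

(** The point [p] witnesses that the cone is proper; the sign of the form at [p] is left open. A
    sign at a given point is obtained by first adding its opposite to the cone. *)
Lemma convex_cone_support {R : realType} {n : nat} (C : set 'rV[R]_n)
    (p : 'rV[R]_n) :
  convex_cone C -> ~ C p ->
  exists2 u : 'cV[R]_n, u != 0 & forall x, C x -> 0 <= (x *m u) 0 0.
Proof.
(* Enlarge the lineality space [W] of [C] until it is a hyperplane. *)
suff H k (W : 'M[R]_n) (D : set 'rV[R]_n) q : (n - \rank W <= k)%N ->
    convex_cone D -> (forall w : 'rV_n, (w <= W)%MS -> D w) -> ~ D q ->
    exists2 u : 'cV[R]_n, u != 0 & forall x, D x -> 0 <= (x *m u) 0 0.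
  move=> coneC Cp; apply: (H n 0 C p) => //; first exact: leq_subr.
  by move=> w; rewrite submx0 => /eqP ->; case: coneC.
elim: k W D q => [|k IHk] W D q rkW coneD WD Dq.
  exfalso; apply/Dq/WD/submx_full.
  by rewrite /row_full eqn_leq rank_leq_row -subn_eq0 -leqn0.
(* If the line through [q'] of direction [v] misses [D], then [D] plus the span of [v] is a larger
   cone that misses [q'] and contains [W + v]; the induction hypothesis applies to it. *)
have grow (v q' : 'rV[R]_n) : ~~ (v <= W)%MS ->
    (forall t : R, ~ D (q' + t *: v)) ->
    exists2 u : 'cV[R]_n, u != 0 & forall x, D x -> 0 <= (x *m u) 0 0.
  move=> vW Dq'.
  have [| | | |u u0 uD] :=
      IHk (W + v)%MS [set x | exists t : R, D (x + t *: v)] q'.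
  - have /rank_ltmx ltW : (W < W + v)%MS.
      rewrite /ltmx addsmxSl; apply: contra vW => /(submx_trans _); apply.
      exact: addsmxSr.
    apply: leq_trans (leq_sub2l n ltW) _.
    by rewrite subnS -subn1 leq_subLR add1n.
  - exact: convex_cone_add_line.
  - move=> w /sub_addsmxP [[a b] /= ->].
    have [c ->] : exists c : R, b *m v = c *: v.
      by exists (b 0 0); rewrite -mul_scalar_mx -mx11_scalar.
    exists (- c); rewrite -addrA scaleNr subrr addr0.
    by apply: WD; exact: submxMl.
  - by case=> t /Dq'.
  exists u => // x Dx; apply: uD; exists 0; by rewrite scale0r addr0.
have Wq : ~~ (q <= W)%MS by apply/negP => /WD.
(* Either some line of direction [q] misses [D], and [q] is the new direction, or all of them meet
   [D], as [convex_cone_line] requires. *)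
have [Dline|] := pselect (forall x, exists t : R, D (x + t *: q)); last first.
  by move=> /existsNP[q' /forallNP Dq']; exact: grow Wq Dq'.
(* If [W + q] is not full, a unit vector [w] outside it, corrected by a multiple of [q], gives the
   new direction; it is not in [W] since [w] is not in [W + q]. *)
have [Wfull|] := boolP (row_full (W + q)%MS); last first.
  rewrite -sub1mx => /row_subPn[i wWq]; set w := row i _ in wWq.
  have [tau Dtau] := convex_cone_line _ _ w coneD Dq Dline.
  apply: grow Dtau; apply: contra wWq => wW.
  rewrite -[w](addrK (tau *: q)); apply: addmx_sub.
    by apply: submx_trans (addsmxSl _ _).
  by rewrite eqmx_opp; apply: scalemx_sub; exact: addsmxSr.
(* Now [W] is a hyperplane without [q]: some column of its cokernel kills [W] but not [q], and [u]
   rescales it to the value [-1] at [q]. *)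
have [v Wv qv] : exists2 v : 'cV_n, W *m v = 0 & (q *m v) 0 0 != 0.
  have /rV0Pn[j qj] : q *m cokermx W != 0 by rewrite -submxE.
  exists (col j (cokermx W)); rewrite colE mulmxA.
    by rewrite mulmx_coker mul0mx.
  by rewrite -colE mxE.
pose u : 'cV_n := - ((q *m v) 0 0)^-1 *: v.
have Wu : W *m u = 0 by rewrite /u -scalemxAr Wv scaler0.
have qu : (q *m u) 0 0 = - 1.
  by rewrite /u -scalemxAr; set c := q *m v in qv *; rewrite mxE mulNr mulVf.
exists u.
  by apply/eqP => u0; move: qu; rewrite u0 mulmx0 mxE; lra.
move=> x Dx.
have /sub_addsmxP[[a b] /= xE] := submx_full x Wfull.
have bE : b *m q = b 0 0 *: q by rewrite -mul_scalar_mx -mx11_scalar.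
have -> : (x *m u) 0 0 = - b 0 0.
  rewrite xE bE mulmxDl -mulmxA Wu mulmx0 add0r -scalemxAl mxE.
  by rewrite qu mulrN1.
(* If [b 0 0 > 0], removing the component of [x] in [W], whose opposite lies in [D], leaves a
   positive multiple of [q] in [D]. *)
rewrite oppr_ge0 leNgt; apply/negP => b0; apply: Dq.
have [_ CD CZ] := coneD.
have := CZ (b 0 0)^-1 _ _ (CD _ _ Dx (WD (- (a *m W)) _)).
rewrite xE bE addrAC subrr add0r scalerA mulVf ?gt_eqF// scale1r; apply.
  by rewrite invr_ge0 ltW.
by rewrite eqmx_opp submxMl.
Qed.

(** * Conic combinations and Caratheodory's reduction *)

Definition conic_comb {R : realType} {V : lmodType R} {T : Type} (D : set T)
    (phi : T -> V) (m : nat) (v : V) : Prop :=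
  exists (c : 'I_m -> R) (t : 'I_m -> T),
    [/\ forall j, 0 <= c j, forall j, D (t j) & v = \sum_j c j *: phi (t j)].

Lemma convex_cone_conic_comb {R : realType} {V : lmodType R} {T : Type}
    (D : set T) (phi : T -> V) :
  convex_cone [set v | exists m, conic_comb D phi m v].
Proof.
split=> /=.
- have t : 'I_0 -> T by case.
  by exists 0, (fun=> 0), t; split=> [[]//|[]//|]; rewrite big_ord0.
- move=> v w [m1 [c1 [t1 [c1_ge0 Dt1 ->]]]] [m2 [c2 [t2 [c2_ge0 Dt2 ->]]]].
  exists (m1 + m2)%N.
  exists (fun j : 'I_(m1 + m2) =>
    match fintype.split j with inl a => c1 a | inr b => c2 b end).
  exists (fun j : 'I_(m1 + m2) =>
    match fintype.split j with inl a => t1 a | inr b => t2 b end).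
  split=> [j|j|]; [by case: fintype.split|by case: fintype.split|].
  rewrite big_split_ord /=; congr (_ + _); apply: eq_bigr => j _.
    by rewrite (unsplitK (inl j)).
  by rewrite (unsplitK (inr j)).
- move=> a v a_ge0 [m [c [t [c_ge0 Dt ->]]]].
  exists m, (fun j => a * c j), t; split=> // [j|]; first exact: mulr_ge0.
  by rewrite scaler_sumr; apply: eq_bigr => j _; rewrite scalerA.
Qed.

Lemma conic_comb_gen {R : realType} {V : lmodType R} {T : Type}
    (D : set T) (phi : T -> V) (x : T) : D x -> conic_comb D phi 1 (phi x).
Proof.
move=> Dx; exists (fun=> 1), (fun=> x).
by rewrite big_ord1 scale1r.
Qed.

(** Subtract from [c] the multiple of the relation [lam] given by the least ratio [c i / lam i] over
    the [i] with [lam i > 0]: coefficients stay nonnegative and the one reaching the minimum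
    vanishes. *)
Lemma conic_comb_drop {R : realType} {V : lmodType R} {T : Type}
    (D : set T) (phi : T -> V) (m : nat) (c lam : 'I_m.+1 -> R)
    (t : 'I_m.+1 -> T) :
  (forall j, 0 <= c j) -> (forall j, D (t j)) ->
  \sum_j lam j *: phi (t j) = 0 -> (exists i, 0 < lam i) ->
  conic_comb D phi m (\sum_j c j *: phi (t j)).
Proof.
move=> c_ge0 Dt lam0 [i0 lami0].
have [k lamk k_min] := @Order.TotalTheory.arg_minP _ _ _ i0
  (fun i => 0 < lam i) (fun i => c i / lam i) lami0.
pose r := c k / lam k.
exists (fun j => c (lift k j) - r * lam (lift k j)), (fun j => t (lift k j)).
split=> // [j|].
  rewrite subr_ge0; have [lamj|lamj] := ltP 0 (lam (lift k j)).
    by rewrite -ler_pdivlMr//; exact: k_min.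
  apply: le_trans (c_ge0 _); apply: mulr_ge0_le0 => //.
  by rewrite divr_ge0// ltW.
transitivity (\sum_j (c j - r * lam j) *: phi (t j)).
  under [RHS]eq_bigr do rewrite scalerBl -scalerA.
  by rewrite sumrB -scaler_sumr lam0 scaler0 subr0.
by rewrite (bigD1_ord k)//= /r divfK ?gt_eqF// subrr scale0r add0r.
Qed.

Lemma conic_caratheodory {R : realType} {n : nat} {T : Type}
    (D : set T) (phi : T -> 'rV[R]_n) (m : nat) (v : 'rV[R]_n) :
  conic_comb D phi m v ->
  exists2 m' : nat, (m' <= n)%N & conic_comb D phi m' v.
Proof.
elim: m v => [|m IHm] v; first by exists 0.
have [mn|nm] := leqP m.+1 n; first by exists m.+1.
move=> [c [t [c_ge0 Dt ->]]]; apply: IHm.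
pose A := \matrix_(j < m.+1) phi (t j).
have /rowV0Pn[lam /sub_kermxP lamA lam0] : kermx A != 0.
  rewrite kermx_eq0; apply/negP => /eqP rkA.
  by have := rank_leq_col A; rewrite rkA leqNgt nm.
have lam_sum : \sum_j lam 0 j *: phi (t j) = 0.
  by rewrite -[RHS]lamA mulmx_sum_row; apply: eq_bigr => j _; rewrite rowK.
have /rV0Pn[i lami] := lam0.
have [lami_gt0|lami_le0] := ltP 0 (lam 0 i).
  by apply: conic_comb_drop lam_sum _ => //; exists i.
apply: (@conic_comb_drop _ _ _ _ _ _ _ (fun j => - lam 0 j)) => //.
  by under eq_bigr do rewrite scaleNr; rewrite sumrN lam_sum oppr0.
by exists i; rewrite oppr_gt0 lt_neqAle lami.
Qed.

(** * Integrals of finite sums and Richter's theorem *)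

Section Rintegral_sum.
Context {d : measure_display} {T : measurableType d} {R : realType}.
Variables (mu : {measure set T -> \bar R}) (D : set T).
Hypothesis mD : measurable D.

Lemma integrable_linear_comb (I : Type) (s : seq I) (f : I -> T -> R)
    (u : I -> R) :
  (forall i, mu.-integrable D (EFin \o f i)) ->
  mu.-integrable D (EFin \o (fun x => \sum_(i <- s) f i x * u i)).
Proof.
move=> intf.
rewrite (_ : EFin \o _ =
    fun x => (\sum_(i <- s) (EFin \o f i) x * (u i)%:E)%E); last first.
  by apply/funext => x /=; rewrite -sumEFin.
by apply: integrable_sum => // i _; exact: integrableZr.
Qed.

Lemma Rintegral_linear_comb (I : Type) (s : seq I) (f : I -> T -> R)
    (u : I -> R) :
  (forall i, mu.-integrable D (EFin \o f i)) ->
  \int[mu]_(x in D) (\sum_(i <- s) f i x * u i) =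
  \sum_(i <- s) (\int[mu]_(x in D) f i x) * u i.
Proof.
move=> intf; elim: s => [|i s IHs].
  under eq_Rintegral do rewrite big_nil.
  by rewrite big_nil /Rintegral integral0.
under eq_Rintegral do rewrite big_cons.
rewrite big_cons RintegralD//; last exact: integrable_linear_comb.
  by rewrite IHs RintegralZr.
have := @integrable_linear_comb _ [:: i] f u intf.
by under [X in EFin \o X]funext do rewrite big_seq1.
Qed.

Lemma Rintegral_ae_subset (E : set T) (f : T -> R) :
  measurable E -> E `<=` D -> mu (D `\` E) = 0%E ->
  mu.-integrable D (EFin \o f) ->
  \int[mu]_(x in D) f x = \int[mu]_(x in E) f x.
Proof.
move=> mE ED mu0 intf; rewrite /Rintegral.
rewrite (@negligible_integral _ _ _ mu D (D `\` E))//.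
  by rewrite setDD setIidr.
exact: measurableD.
Qed.

End Rintegral_sum.

Lemma Rintegral_conic_comb {d : measure_display} {T : measurableType d}
    {R : realType} (mu : {measure set T -> \bar R}) (n : nat) (D : set T)
    (phi : 'I_n -> T -> R) :
  measurable D -> (forall i, mu.-integrable D (EFin \o phi i)) ->
  exists m, conic_comb D (fun t => \row_i phi i t) m
    (\row_i \int[mu]_(x in D) phi i x).
Proof.
(* [D] varies in the induction because it shrinks to the zero set of a linear form along [phi]. *)
elim: n D phi => [|n IHn] D phi mD intphi.
  have t : 'I_0 -> T by case.
  by exists 0, (fun=> 0), t; split=> [[]//|[]//|]; apply/rowP; case.
set P := fun t => \row_i phi i t; set s := \row_i _.
apply: contrapT => hull_s.
pose C : set 'rV[R]_n.+1 := [set v | exists m, conic_comb D P m v].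
have [C0 CD CZ] : convex_cone C := convex_cone_conic_comb D P.
(* [C'] is the cone generated by [C] and [- s], so a form nonnegative on [C'] is nonnegative on [C]
   and nonpositive at [s]. *)
pose C' : set 'rV[R]_n.+1 := [set v | exists2 t : R, 0 <= t & C (v + t *: s)].
have coneC' : convex_cone C'.
  split=> /=.
  - by exists 0; rewrite // scale0r addr0.
  - move=> x y [a a0 Ca] [b b0 Cb]; exists (a + b); first exact: addr_ge0.
    by rewrite scalerDl addrACA; exact: CD.
  - move=> t x t0 [a a0 Ca]; exists (t * a); first exact: mulr_ge0.
    by rewrite -scalerA -scalerDr; exact: CZ.
have C's : ~ C' s.
  move=> [t t0]; rewrite -{1}[s]scale1r -scalerDl => Cs; apply: hull_s.
  have := CZ (1 + t)^-1 _ _ Cs; rewrite scalerA mulVf ?scale1r; last by lra.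
  by apply; rewrite invr_ge0; lra.
have [u u0 uC'] := convex_cone_support _ s coneC' C's.
pose g x := \sum_i phi i x * u i 0.
have PuE x : (P x *m u) 0 0 = g x.
  by rewrite mxE; apply: eq_bigr => i _; rewrite mxE.
have g_ge0 x : D x -> 0 <= g x.
  move=> Dx; rewrite -PuE; apply: uC'; exists 0 => //.
  by rewrite scale0r addr0; exists 1; exact: conic_comb_gen.
have intg : mu.-integrable D (EFin \o g) by exact: integrable_linear_comb.
have suE : (s *m u) 0 0 = \int[mu]_(x in D) g x.
  rewrite Rintegral_linear_comb// mxE; apply: eq_bigr => i _.
  by rewrite mxE.
have int_g0 : \int[mu]_(x in D) g x = 0.
  apply/eqP; rewrite eq_le Rintegral_ge0// andbT.
  have := uC' (- s); rewrite mulNmx mxE oppr_ge0.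
  by rewrite suE; apply; exists 1 => //; rewrite scale1r addNr.
pose D' := D `&` [set x | g x = 0].
have mg := measurable_int _ intg.
have DD'E : D `\` D' = D `&` [set x | (EFin \o g) x != 0%E].
  apply/seteqP; split=> x /= [Dx].
    by move=> D'x; split=> //; apply/eqP => -[gx0]; exact: D'x.
  by move=> /eqP gx0; split=> // -[_ gx]; apply: gx0; rewrite gx.
have mDD' : measurable (D `\` D') by rewrite DD'E; exact: emeasurable_neq.
have mD' : measurable D'.
  rewrite (_ : D' = D `\` (D `\` D')); first exact: measurableD.
  by rewrite setDD setIidr//; exact: subIsetl.
(* A nonnegative function with zero integral vanishes almost everywhere. *)
have muD' : mu (D `\` D') = 0%E.
  apply: measure_negligible => //.
  have /(ae_eq_integral_abs mu mD mg) : (\int[mu]_(x in D) `|(g x)%:E| = 0)%E.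
    rewrite -[RHS]/(0 : R)%:E -int_g0 fineK; last exact: integrable_fin_num.
    by apply: eq_integral => x /set_mem /g_ge0 gx; rewrite gee0_abs.
  apply: negligibleS; rewrite DD'E => x /= [Dx /eqP gx0].
  by apply/not_implyP.
(* On [D'] the coordinate [k] is determined by the others, to which the induction hypothesis
   applies. *)
have /cV0Pn[k uk] := u0.
have [|m [c [t [c_ge0 D't sE]]]] := IHn D' (fun i => phi (lift k i)) mD'.
  by move=> i; apply: integrableS (intphi _) => //; exact: subIsetl.
apply: hull_s; exists m, c, t; split=> // [j|]; first by case: (D't j).
(* The discrepancy [w] vanishes off coordinate [k] by induction, and [u] kills it since [u] kills
   both [s] and the atoms; as [u k 0 != 0], it is zero. *)
apply/eqP; rewrite -subr_eq0; set w := _ - _.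
have w_lift i : w 0 (lift k i) = 0.
  have := congr1 (fun v : 'rV_n => v 0 i) sE.
  rewrite /w !mxE !summxE => sEi.
  rewrite (@Rintegral_ae_subset _ _ _ mu D mD D')//; last exact: subIsetl.
  rewrite sEi; apply/eqP; rewrite subr_eq0; apply/eqP.
  by apply: eq_bigr => j _; rewrite !mxE.
have wu : (w *m u) 0 0 = 0.
  rewrite /w mulmxBl mxE [X in _ + X]mxE suE int_g0 mulmx_suml summxE.
  rewrite big1 ?subrr// => j _; rewrite -scalemxAl mxE PuE.
  by case: (D't j) => _ ->; rewrite mulr0.
have wk : w 0 k = 0.
  move: wu; rewrite mxE (bigD1_ord k)//= big1 ?addr0; last first.
    by move=> i _; rewrite w_lift mul0r.
  by move/eqP; rewrite mulf_eq0 (negbTE uk) orbF => /eqP.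
apply/eqP/rowP => i; rewrite [RHS]mxE.
by have [j ->|->] := unliftP k i.
Qed.

(** * Bases extracted from finite spanning families *)

Lemma has_dim_of_span {F : fieldType} {V : lmodType F} (W : set V) (m : nat)
    (g : 'I_m -> V) :
  (forall i, W (g i)) ->
  (forall w, W w -> exists a : 'I_m -> F, w = \sum_i a i *: g i) ->
  exists d, has_dim W d.
Proof.
elim: m g => [|m IHm] g Wg span_g; first by exists 0, g; split=> // a _ [].
have [free_g|] := pselect (forall a : 'I_m.+1 -> F,
  \sum_i a i *: g i = 0 -> forall i, a i = 0); first by exists m.+1, g; split.
move=> /existsNP[a /not_implyP[a_rel /existsNP[k /eqP ak]]].
apply: (IHm (fun i => g (lift k i))) => // w Ww.
have [b ->] := span_g w Ww.
(* Subtracting [b k / a k] times the relation eliminates the generator [g k]. *)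
exists (fun i => b (lift k i) - b k / a k * a (lift k i)).
transitivity (\sum_i (b i - b k / a k * a i) *: g i).
  under [RHS]eq_bigr do rewrite scalerBl -scalerA.
  by rewrite sumrB -scaler_sumr a_rel scaler0 subr0.
by rewrite (bigD1_ord k)//= divfK// subrr scale0r add0r.
Qed.

(** * Integration against a finitely atomic measure *)

Section atomic_integral.
Context {d : measure_display} {T : measurableType d} {R : realType} {n : nat}.
Variables (c : 'I_n -> {nonneg R}) (x : 'I_n -> T) (D : set T).
Hypotheses (mD : measurable D) (Dx : forall j, D (x j)).

Lemma ge0_integral_atomic (f : T -> \bar R) :
  (forall y, D y -> (0 <= f y)%E) -> measurable_fun D f ->
  (\int[atomic c x]_(y in D) f y = \sum_(j < n) (c j)%:num%:E * f (x j))%E.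
Proof.
move=> f_ge0 mf.
(* The weighted point masses, continued by the zero measure past [n], present [atomic] as a finite
   sum of measures. *)
pose m (k : nat) : {measure set T -> \bar R} :=
  if insub k is Some j then mscale (c j) (dirac (x j)) else mzero.
rewrite (@eq_measure_integral _ _ _ _ (msum m n)); last first.
  move=> A mA AD; rewrite /= /atomic /msum; apply: eq_bigr => j _.
  by rewrite /m valK.
rewrite ge0_integral_measure_sum//; apply: eq_bigr => j _.
rewrite /m valK ge0_integral_mscale// integral_dirac// diracE mem_set//.
by rewrite mul1e.
Qed.

Lemma integrable_atomic (f : T -> R) :
  measurable_fun D (EFin \o f) ->
  (atomic c x).-integrable D (EFin \o f).
Proof.
move=> mf; apply/integrableP; split=> //.
rewrite ge0_integral_atomic//; last exact: measurableT_comp.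
by rewrite /= sumEFin ltry.
Qed.

Lemma Rintegral_atomic (f : T -> R) :
  measurable_fun D (EFin \o f) ->
  \int[atomic c x]_(y in D) f y = \sum_(j < n) (c j)%:num * f (x j).
Proof.
move=> mf; rewrite /Rintegral integralE.
rewrite !ge0_integral_atomic//; [|exact: measurable_funeneg|
  exact: measurable_funepos].
rewrite funerpos funerneg/= !sumEFin -EFinB /= -sumrB.
apply: eq_bigr => j _; rewrite -mulrBr.
by have /(congr1 (@^~ (x j))) /= := funrposBneg f => <-.
Qed.
End atomic_integral.

(** * Quaternion units and coordinates *)

Section quaternion_units.
Context {R : realType}.
Implicit Types (p q : quat R) (l : 'I_4).

Definition qunit l : quat R := \row_i (i == l)%:R.

Lemma quatZE (a : R) p :
  ((q0 (a *: p) = a * q0 p)%R * (q1 (a *: p) = a * q1 p)%R *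
   (q2 (a *: p) = a * q2 p)%R * (q3 (a *: p) = a * q3 p)%R)%type.
Proof. by rewrite /q0 /q1 /q2 /q3 !mxE. Qed.

Lemma qoneE : qone R = mkquat 1 0 0 0.
Proof. by []. Qed.

Lemma qmulE p q : p * q = qmul p q.
Proof. by []. Qed.

Lemma qscalel (a : R) p : (a *: qone R) * p = a *: p.
Proof.
by apply: quatP; rewrite qmulE !(quatZE, mkquatE, qoneE); ring.
Qed.

Lemma qscalAr (a : R) p q : p * (a *: q) = a *: (p * q).
Proof.
by apply: quatP; rewrite !qmulE !(quatZE, mkquatE); ring.
Qed.

Lemma qscalAl (a : R) p q : (a *: p) * q = a *: (p * q).
Proof.
by apply: quatP; rewrite !qmulE !(quatZE, mkquatE); ring.
Qed.

Lemma ord4P (P : 'I_4 -> Prop) :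
  P (@Ordinal 4 0 isT) -> P (@Ordinal 4 1 isT) -> P (@Ordinal 4 2 isT) ->
  P (@Ordinal 4 3 isT) -> forall l, P l.
Proof.
move=> P0 P1 P2 P3 [i lti].
by case: i lti => [|[|[|[|//]]]] lti; rewrite (bool_irrelevance lti isT).
Qed.

Lemma sum4E (V : nmodType) (F : 'I_4 -> V) :
  \sum_l F l = F (@Ordinal 4 0 isT) + F (@Ordinal 4 1 isT) +
               F (@Ordinal 4 2 isT) + F (@Ordinal 4 3 isT).
Proof.
rewrite !big_ord_recr big_ord0 /= add0r.
by congr (F _ + F _ + F _ + F _); apply: val_inj.
Qed.

Lemma quat_sum_units q : q = \sum_l (q 0 l *: qone R) * qunit l.
Proof.
rewrite sum4E; apply: quatP; rewrite !(quatDE, qscalel, quatZE);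
  by rewrite /q0 /q1 /q2 /q3 !mxE /=; ring.
Qed.

Lemma qcoord_re q l : q 0 l = q0 (qconj (qunit l) * q).
Proof.
by elim/ord4P: l; rewrite qmulE !mkquatE /q0 /q1 /q2 /q3 !mxE /=; ring.
Qed.

(** The real part is half of [q] plus its conjugate, written in the shape of [lincomb] so that
    closure of [E] applies. *)
Lemma qre_half q :
  (2^-1 *: qone R) * q * 1 + (2^-1 *: qone R) * qconj q * 1 = q0 q *: qone R.
Proof.
rewrite !mulr1 !qscalel.
by apply: quatP; rewrite !(quatDE, quatZE, qoneE, mkquatE); field.
Qed.

Lemma q0_mul p q : q0 (p * q) = \sum_l (-1) ^+ (l != 0) * p 0 l * q 0 l.
Proof. by rewrite sum4E qmulE mkquatE /= expr0 expr1 /q0 /q1 /q2 /q3; ring. Qed.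

Lemma qreal_coord q : q = qconj q -> q = q0 q *: qone R.
Proof.
move=> qE; have E1 := congr1 (@q1 R) qE; have E2 := congr1 (@q2 R) qE.
have E3 := congr1 (@q3 R) qE; move: E1 E2 E3; rewrite !mkquatE => E1 E2 E3.
by apply: quatP; rewrite !(quatZE, qoneE, mkquatE); lra.
Qed.

End quaternion_units.

(** * Coordinate functions and the hermitian part of [E] *)

Section function_spaces.
Context {R : realType} {K : set (quat R)} {E : set (K -> quat R)}.
Hypotheses (subE : two_sided_subspace E) (starE : star_invariant E).

Definition cpart (f : K -> quat R) (l : 'I_4) : K -> quat R :=
  fun x => f x 0 l *: qone R.

(** Coordinate [l] of [f] is the real part of [h], the product of [f] on the left by a conjugate
    unit. Linearity keeps [h] in [E], and star-invariance its real part. *)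
Lemma her_cpart (f : K -> quat R) (l : 'I_4) : E f -> her E (cpart f l).
Proof.
move=> Ef; split; last first.
  by apply/funext => x; apply: quatP;
    rewrite /star !(mkquatE, quatZE, qoneE) ?mulr0 ?oppr0.
pose h := lincomb (qconj (qunit l)) f 1 0 f 1.
have Eh : E h by apply: subE.2.
rewrite (_ : cpart f l =
    lincomb (2^-1 *: qone R) h 1 (2^-1 *: qone R) (star h) 1).
  by apply: subE.2 => //; exact: starE.
apply/funext => x; rewrite /lincomb /star qre_half /cpart qcoord_re.
by rewrite /h /lincomb !mulr1 mul0r addr0.
Qed.

(** The sum is nested in binary [lincomb]s so that linear functionals can be rewritten through
    it. *)
Lemma cpart_sum (f : K -> quat R) :
  f = lincomb 1 (lincomb 1 (cpart f (@Ordinal 4 0 isT))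
                           (qunit (@Ordinal 4 0 isT))
                         1 (cpart f (@Ordinal 4 1 isT))
                           (qunit (@Ordinal 4 1 isT))) 1
              1 (lincomb 1 (cpart f (@Ordinal 4 2 isT))
                           (qunit (@Ordinal 4 2 isT))
                         1 (cpart f (@Ordinal 4 3 isT))
                           (qunit (@Ordinal 4 3 isT))) 1.
Proof.
apply/funext => x; rewrite {1}[f x]quat_sum_units sum4E /lincomb /cpart.
by rewrite !mul1r !mulr1 !addrA.
Qed.

Lemma linear_functional_her_ext (L M : (K -> quat R) -> quat R) :
  linear_functional_on E L -> linear_functional_on E M ->
  (forall f, her E f -> L f = M f) -> forall f, E f -> L f = M f.
Proof.
move=> linL linM LM f Ef; rewrite [f]cpart_sum.
have Ec l : E (cpart f l) by case: (her_cpart f l Ef).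
by rewrite !(linL, linM) ?LM//; do ?[exact: her_cpart|exact: subE.2].
Qed.

Lemma real_lincomb (a : R) (f g : K -> quat R) :
  a *: f + g = lincomb (a *: qone R) f 1 1 g 1.
Proof. by apply/funext => x; rewrite /lincomb qscalel mul1r !mulr1. Qed.

Lemma subspace_sum (I : Type) (s : seq I) (a : I -> R) (e : I -> K -> quat R) :
  (forall i, E (e i)) -> E (\sum_(i <- s) a i *: e i).
Proof.
move=> Ee; elim: s => [|i s IHs]; first by rewrite big_nil; exact: subE.1.
by rewrite big_cons real_lincomb; exact: subE.2.
Qed.

Lemma linear_functional_sum (L : (K -> quat R) -> quat R) (I : Type)
    (s : seq I) (a : I -> R) (e : I -> K -> quat R) :
  linear_functional_on E L -> (forall i, E (e i)) ->
  L (\sum_(i <- s) a i *: e i) = \sum_(i <- s) a i *: L (e i).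
Proof.
move=> linL Ee; elim: s => [|i s IHs]; last first.
  rewrite !big_cons real_lincomb linL//; last exact: subspace_sum.
  by rewrite IHs qscalel mul1r !mulr1.
rewrite !big_nil.
(* This gives [L 0 = 0]. *)
have := linL 0 0 0 0 0 0 subE.1 subE.1.
rewrite !mul0r addr0 => <-; congr L; apply/funext => x.
by rewrite /lincomb !mul0r addr0.
Qed.

(** For real-valued [f] equal to the sum of the [a i * e i], taking real parts writes [f] as a real
    combination of the coordinates of the [e i], which lie in [her E]. *)
Lemma has_dim_her : @finite_dim (quat R) (K -> (quat R)^o) E ->
  exists d, @has_dim R (K -> quat R) (her E) d.
Proof.
move=> [m [e [Ee _ span_e]]].
pose g (il : 'I_m * 'I_4) := cpart (e il.1) il.2.
apply: (@has_dim_of_span _ _ _ #|{: 'I_m * 'I_4}|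
  (fun k => g (enum_val k))) => [k|f [Ef fE]]; first exact: her_cpart.
have [a fa] := span_e f Ef.
pose b (il : 'I_m * 'I_4) := (-1) ^+ (il.2 != 0) * a il.1 0 il.2.
exists (fun k => b (enum_val k)).
transitivity (\sum_il b il *: g il); last first.
  rewrite (reindex (@enum_val _ {: 'I_m * 'I_4})) //=.
  by apply: onW_bij; exact: enum_val_bij.
apply/funext => x.
have fxE : f x = q0 (f x) *: qone R by apply: qreal_coord; rewrite {1}fE.
rewrite fxE fa !fct_sumE -(pair_bigA _ (fun i l => b (i, l) *: g (i, l) x)) /=.
rewrite /q0 summxE scaler_suml; apply: eq_bigr => i _.
rewrite -/(q0 (a i * e i x)) q0_mul scaler_suml.
by apply: eq_bigr => l _; rewrite scalerA.
Qed.

End function_spaces.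

(** * Coordinates of functions extended by zero *)

Section coordinates.
Context {R : realType} {K : set (quat R)}.
Implicit Types (f : K -> quat R) (l : 'I_4).

Lemma coordK_val f l (x : K) : coordK f l (\val x) = f x 0 l.
Proof.
rewrite /coordK; have /(congr1 (@^~ x)) /= := valLK 0 f.
by rewrite /sigL /= => ->.
Qed.

Lemma coordK_cpart f l : coordK (cpart f l) 0 = coordK f l.
Proof.
apply/funext => y; rewrite /coordK /=.
(* The case [None] is that of [y] outside [K], where the extension is 0. *)
by case: ('oinv_set_val y) => [x|] /=; rewrite !mxE ?mulr1.
Qed.

Lemma coordK_real f l : f = star f -> l != 0 -> coordK f l = cst 0.
Proof.
move=> fE l0; apply/funext => y; rewrite /coordK /=.
case: ('oinv_set_val y) => [x|] /=; last by rewrite mxE.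
have /qreal_coord -> : f x = qconj (f x) by rewrite {1}fE.
by elim/ord4P: l l0 => //; rewrite !mxE mulr0.
Qed.

(** The weights are real, hence central among the quaternions. *)
Lemma linear_functional_atomic (E : set (K -> quat R)) (n : nat)
    (c : 'I_n -> R) (x : 'I_n -> K) :
  linear_functional_on E (fun f => \sum_j c j *: f (x j)).
Proof.
move=> f g a b a' b' _ _; rewrite !mulr_sumr !mulr_suml -big_split /=.
by apply: eq_bigr => j _; rewrite scalerDr !qscalAr !qscalAl.
Qed.

End coordinates.

(** * Construction of the representing measure *)

Theorem corollary3p6 (R : realType) (K : set (quat R)) (closedK : closed K)
    (E : set (K -> quat R))
    (continuousE : forall f : K -> quat R, E f -> continuous f)
    (subspaceE : two_sided_subspace E)
    (starE : star_invariant E)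
    (L : (K -> quat R) -> quat R)
    (linearL : linear_functional_on E L)
    (momentL : exists mu : {measure set (borel_quat R) -> \bar R},
      radon_on K mu /\
      forall f, her E f -> qintegrable mu f /\ L f = qintegral mu f)
    (finiteE : @finite_dim (quat R) (K -> (quat R)^o) E) :
  exists d : nat, @has_dim R (K -> quat R) (her E) d /\
  exists (n : nat) (c : 'I_n -> {nonneg R}) (x : 'I_n -> K),
    let nu : {measure set (borel_quat R) -> \bar R} :=
      @atomic _ (borel_quat R) R n c (fun j => \val (x j)) in
    (n <= d)%N /\
    forall f, E f ->
      [/\ qintegrable nu f, L f = qintegral nu f &
          qintegral nu f = \sum_(j < n) (c j)%:num *: f (x j)].
Proof.
have mK : measurable (K : set (borel_quat R)).
  rewrite -[K]setCK; apply: measurableC; apply: sub_sigma_algebra.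
  exact: closed_openC.
have [mu [_ mu_her]] := momentL.
have [d dim_her] := has_dim_her subspaceE starE finiteE.
exists d; split => //; have [b [her_b _ span_b]] := dim_her.
have int_b i : mu.-integrable K (EFin \o coordK (b i) 0).
  by have [] := mu_her _ (her_b i); exact.
(* The map to [R^d] has as components the real coordinates of the basis, so Caratheodory's reduction
   yields [n <= d]. *)
have [m /conic_caratheodory[n le_nd [c [t [c_ge0 Kt intE]]]]] :=
  Rintegral_conic_comb mu d K (fun i => coordK (b i) 0) mK int_b.
pose cn j : {nonneg R} := NngNum (c_ge0 j).
pose x j : K := SigSub (mem_set (Kt j)).
exists n, cn, x => nu; split => // f Ef.
(* [cpart f l] lies in [her E], hence is integrable for [mu], and its real coordinate is coordinate
   [l] of [f]. *)
have mf l : measurable_fun (K : set (borel_quat R)) (EFin \o coordK f l).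
  have [/(_ 0) + _] := mu_her _ (her_cpart subspaceE starE f l Ef).
  by rewrite coordK_cpart => /measurable_int.
have nu_f : qintegral nu f = \sum_(j < n) (cn j)%:num *: f (x j).
  apply/rowP => l; rewrite mxE summxE Rintegral_atomic//.
  by apply: eq_bigr => j _; rewrite coordK_val mxE.
split=> //.
  move=> l; apply: integrable_atomic => // j; exact: Kt.
rewrite nu_f; pose M f := \sum_(j < n) (cn j)%:num *: (f (x j) : quat R).
have linM : linear_functional_on E M by exact: linear_functional_atomic.
apply: (linear_functional_her_ext subspaceE starE L M) => //.
have Eb i : E (b i) by case: (her_b i).
move=> _ /span_b[a ->]; rewrite !(linear_functional_sum subspaceE)//.
apply: eq_bigr => i _; congr (_ *: _).
have [_ ->] := mu_her _ (her_b i).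
apply/rowP => l; rewrite mxE summxE.
(* The real coordinate is [intE]; the imaginary ones vanish on both sides. *)
have [->|l0] := eqVneq l 0.
  have := congr1 (fun v : 'rV_d => v 0 i) intE; rewrite mxE summxE => ->.
  by apply: eq_bigr => j _; rewrite !mxE -coordK_val.
have b_l := coordK_real _ _ (her_b i).2 l0.
rewrite b_l big1 => [|j _].
  by rewrite /Rintegral integral0.
by rewrite mxE -coordK_val b_l mulr0.
Qed.
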